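(* Let $p$ and $q$ be distinct primes and $\xi=\log q/\log p$. Assume that $(a,b)$ is an upper or lower best approximation for $\xi$ and set $\alpha=p^a/q^b$. If $\left(p^{a_1}/q^{b_1},p^{a_2}/q^{b_2},\dots,p^{a_N}/q^{b_N}\right)$ (with $(a_n,b_n)\in\mathcal N$) is a factorization of $\alpha$ which attains the infimum in $m_t(\alpha)$ for some $t>1$, then for every $1\le n\le N$, $(a_n,b_n)$ is an upper or lower best approximation for $\xi$.
   Context: $\mathbb N_0=\{0,1,2,\dots\}$, $\mathcal N=\{(a,b)\in\mathbb N_0^2:(a,b)\neq(0,0)\}$, $\mathcal G=\{(a,b)\in\mathcal N:\gcd(a,b)=1\}$ (convention $\gcd(a,0)=a$; also $a/0=\infty$ for $a\in\mathbb N$). For a positive irrational real $\xi$: $\mathcal U(\xi)=\{(a,b)\in\mathcal N:a>b\xi\}$, $\mathcal L(\xi)=\{(a,b)\in\mathcal N:a<b\xi\}$, $\mathcal U_1(\xi)=\{(a,b)\in\mathcal U(\xi): a/b=\min\{m/n:(m,n)\in\mathcal U(\xi),\ m\le a\}\}$, $\mathcal L_2(\xi)=\{(a,b)\in\mathcal L(\xi): a/b=\max\{m/n:(m,n)\in\mathcal L(\xi),\ n\le b\}\}$. An upper best approximation for $\xi$ is an element of $\mathcal G\cap\mathcal U_1(\xi)$; a lower best approximation for $\xi$ is an element of $\mathcal G\cap\mathcal L_2(\xi)$. For a nonzero algebraic number $\beta$, $m(\beta)=[\mathbb Q(\beta):\mathbb Q]\,h(\beta)$ with $h$ the absolute logarithmic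 Weil height; for a nonzero rational $r/s$ in lowest terms, $m(r/s)=\log\max\{|r|,|s|\}$. A product representation of $\alpha$ is a tuple $(\alpha_1,\dots,\alpha_N)$ ($N\ge1$) of nonzero algebraic numbers with $\prod\alpha_n=\alpha$. For $t>0$, $m_t(\alpha)=\inf\{(\sum_{n=1}^N m(\alpha_n)^t)^{1/t}\}$ over all product representations; a product representation attains the infimum in $m_t(\alpha)$ if its value equals $m_t(\alpha)$. For a positive rational $\alpha\ne1$, a factorization of $\alpha$ is a product representation $(r_1/s_1,\dots,r_N/s_N)$ with $r_n,s_n\in\mathbb N$, $r_n/s_n\ne1$, and $\gcd(r_m,s_n)=1$ for all $m,n$. For $\alpha=p^a/q^b$ every factorization has the form $(p^{a_1}/q^{b_1},\dots,p^{a_N}/q^{b_N})$ with $\sum a_n=a$, $\sum b_n=b$. *)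

(* Defs.v *)
From HB Require Import structures.
From mathcomp Require Import all_boot all_order all_algebra all_field.
From mathcomp Require Import finmap complex.
From mathcomp Require Import all_classical all_reals all_analysis.

Set Implicit Arguments.
Unset Strict Implicit.
Unset Printing Implicit Defensive.

Import Order.TTheory GRing.Theory Num.Theory.

Local Open Scope classical_set_scope.
Local Open Scope ring_scope.

Definition NN : set (nat * nat) := [set ab | ab <> (0%N, 0%N)].

Definition GG : set (nat * nat) := NN `&` [set ab | gcdn ab.1 ab.2 = 1%N].

Section BestApproximations.
Variables (R : realType) (xi : R).
Implicit Types ab mn : nat * nat.

(* Only meant for pairs in NN, so that a / 0 = +oo has a > 0. *)
Definition quot ab : \bar R :=
  if ab.2 == 0%N then +oo%E else (ab.1%:R / ab.2%:R)%:E.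

Definition is_min (S : set (\bar R)) (x : \bar R) := S x /\ lbound S x.
Definition is_max (S : set (\bar R)) (x : \bar R) := S x /\ ubound S x.

Definition UU : set (nat * nat) := NN `&` [set ab | ab.2%:R * xi < ab.1%:R].
Definition LL : set (nat * nat) := NN `&` [set ab | ab.1%:R < ab.2%:R * xi].

Definition UU1 : set (nat * nat) :=
  UU `&` [set ab |
    is_min (quot @` [set mn | UU mn /\ (mn.1 <= ab.1)%N]) (quot ab)].

Definition LL2 : set (nat * nat) :=
  LL `&` [set ab |
    is_max (quot @` [set mn | LL mn /\ (mn.2 <= ab.2)%N]) (quot ab)].

Definition upper_best_approx ab := (GG `&` UU1) ab.
Definition lower_best_approx ab := (GG `&` LL2) ab.

End BestApproximations.

Section WeilHeight.
Variables (R : realType) (K : fieldExtType rat).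

Definition log_plus (x : R) : R := ln (Num.max 1 x).

(* An archimedean place w of K is the class of one real embedding or of two    *)
(* conjugate complex ones, and its local degree [K_w : R] is the size of that  *)
(* class: summing over embeddings counts each place with its local degree.     *)
Definition embeddings : set (K -> R[i]) :=
  [set s | GRing.zmod_morphism s /\ GRing.monoid_morphism s].

(* The non-archimedean places of a number field are represented by the         *)
(* normalized discrete valuations v : K^* ->> Z. The infinite value at 0 is    *)
(* encoded by the dummy value 0, so that each place is represented once.       *)
Definition finite_places : set (K -> int) :=
  [set v | [/\ v 0 = 0,
    (forall x y, x != 0 -> y != 0 -> v (x * y) = v x + v y),
    (forall x y, x != 0 -> y != 0 -> x + y != 0 ->
       Num.min (v x) (v y) <= v (x + y)) &
    exists2 x, x != 0 & v x = 1]].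

Definition valuation_ring (v : K -> int) : set K :=
  [set x | x = 0 \/ 0 <= v x].

Definition valuation_ideal (v : K -> int) : set K :=
  [set x | x = 0 \/ 0 < v x].

Definition residue_classes (v : K -> int) : set (set K) :=
  (fun x => [set y | valuation_ideal v (y - x)]) @` valuation_ring v.

Definition place_norm (v : K -> int) : nat := #|` fset_set (residue_classes v)|.

(* If w is the place of v, above the prime p, and |.|_w extends the p-adic     *)
(* absolute value of Q, then place_abs v x = |x|_w ^ [K_w : Q_p].              *)
Definition place_abs (v : K -> int) (x : K) : R :=
  if x == 0 then 0 else (place_norm v)%:R ^ (- v x).

(* Both sums have finite support, as required by \sum_(_ \in _). *)
Definition weil_height_in (x : K) : R :=
  (\sum_(s \in embeddings) log_plus (Normc.normc (s x)) +
   \sum_(v \in finite_places) log_plus (place_abs v x)) / (\dim {:K})%:R.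

End WeilHeight.

(* The field Q(beta), with beta as an element of it. *)
Definition Qadj (beta : algC) : fieldExtType rat :=
  projT1 (num_field_exists [:: beta]).
Definition Qadj_gen (beta : algC) : Qadj beta :=
  head 0 (s2val (projT2 (projT2 (num_field_exists [:: beta])))).

Section MetricMahlerMeasures.
Variable R : realType.

(* The absolute height does not depend on the field containing beta. *)
Definition weil_height (beta : algC) : R := weil_height_in R (Qadj_gen beta).

Definition mahler (beta : algC) : R :=
  (\dim {:Qadj beta})%:R * weil_height beta.

Definition product_rep (alpha : algC) (s : seq algC) : Prop :=
  [/\ s != [::], all (fun x => x != 0) s & \prod_(x <- s) x = alpha].

Definition rep_value (t : R) (s : seq algC) : R :=
  (\sum_(x <- s) mahler x `^ t) `^ t^-1.

Definition metric_mahler (t : R) (alpha : algC) : R :=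
  inf [set rep_value t s | s in product_rep alpha].

Definition attains_inf (t : R) (alpha : algC) (s : seq algC) : Prop :=
  product_rep alpha s /\ rep_value t s = metric_mahler t alpha.

End MetricMahlerMeasures.

Definition nat_frac (rs : nat * nat) : rat := rs.1%:R / rs.2%:R.

Definition algC_seq (s : seq rat) : seq algC := [seq ratr x | x <- s].

Definition factorization (alpha : rat) (s : seq rat) : Prop :=
  product_rep (ratr alpha) (algC_seq s) /\
  exists rs : seq (nat * nat),
    [/\ s = [seq nat_frac x | x <- rs],
        (forall x, x \in rs -> [/\ (0 < x.1)%N, (0 < x.2)%N & nat_frac x != 1]) &
        (forall x y, x \in rs -> y \in rs -> gcdn x.1 y.2 = 1%N)].

(* Main.v *)
(* For r = p^a / q^b the field Q(r) is Q, with a single embedding, and a finite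
   place at which r has negative valuation must be the q-adic one; hence
   m(r) = max(a log p, b log q). A factorization attaining the infimum thus
   minimizes the sum of the t-th powers of max(a x, b y), x = log p, y = log q,
   over all lists of pairs with the given sum. Call (a, b) above if b y < a x;
   its cost is then a x. In a minimal list an element e above cannot be the sum
   of two pairs that are (weakly) above, by strict superadditivity of z^t for
   t > 1. This gives gcd 1, and it also excludes every f above with f.1 <= e.1,
   a smaller quotient, and f.2 <= e.2. If instead f.2 > e.2, then e.2 can be
   increased by 1 at no cost, and lowering by 1 the second entry of an element
   below decreases the total. Such an element exists: otherwise the sum would be
   above, and if it is a best approximation then every element has a quotient at
   least that of the sum, the one of e being strictly larger, which is absurd.
   Exchanging p and q turns lower approximations into upper ones. *)
Require Import Defs.
From HB Require Import structures.
From mathcomp Require Import all_boot all_order all_algebra all_field.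
From mathcomp Require Import complex.
From mathcomp Require Import all_classical all_reals all_analysis.
From mathcomp Require Import ring zify.

Set Implicit Arguments.
Unset Strict Implicit.
Unset Printing Implicit Defensive.

Import Order.TTheory GRing.Theory Num.Theory.

Local Open Scope classical_set_scope.
Local Open Scope ring_scope.

(** * Minimal decompositions of a pair *)

Section Minimal.
Context {R : realType}.
Implicit Types (x y t : R) (e f : nat * nat) (s : seq (nat * nat)).

(** Since z^t = z z^(t-1) and t - 1 > 0, both u u^(t-1) and v v^(t-1) grow strictly when the base of
    the power becomes u + v. *)
Lemma powR_superadd (t u v : R) :
  1 < t -> 0 < u -> 0 < v -> u `^ t + v `^ t < (u + v) `^ t.
Proof.
move=> t1 u0 v0; have uv0 : 0 < u + v by rewrite addr_gt0.
have split_powR z : 0 < z -> z `^ t = z * z `^ (t - 1).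
  move=> z0; rewrite -{2}(powRr1 (ltW z0)) -powRD ?subrKC //.
  by rewrite (gt_eqF z0) implybT.
rewrite !split_powR // mulrDl ltrD // ltr_pM2l // gt0_ltr_powR ?nnegrE ?subr_gt0 ?ltW //.
  by rewrite ltrDl.
by rewrite ltrDr.
Qed.

Definition cost (x y : R) (e : nat * nat) : R := Num.max (e.1%:R * x) (e.2%:R * y).

Definition total_cost (x y t : R) s : R := \sum_(e <- s) cost x y e `^ t.

Definition pair_sum s : nat * nat := (\sum_(e <- s) e.1, \sum_(e <- s) e.2)%N.

(** Competitors are arbitrary lists, with the pair (0, 0) allowed: the exchange argument can produce
    it. *)
Definition minimal_cost (x y t : R) s :=
  forall s', pair_sum s' = pair_sum s -> total_cost x y t s <= total_cost x y t s'.

Definition above (x y : R) (e : nat * nat) : bool := e.2%:R * y < e.1%:R * x.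

(** Upper best approximation for y / x with the quotients cross-multiplied, so that a / 0 needs no
    separate case. Swapping x with y and transposing e gives the lower ones. *)
Definition best_above (x y : R) (e : nat * nat) :=
  [/\ above x y e, coprime e.1 e.2 &
    forall f, (f.1 <= e.1)%N -> above x y f -> (e.1 * f.2 <= f.1 * e.2)%N].

Definition transpose (e : nat * nat) := (e.2, e.1).

Lemma cost_above x y e : e.2%:R * y <= e.1%:R * x -> cost x y e = e.1%:R * x.
Proof. by move=> h; rewrite /cost max_l. Qed.

Lemma perm_minimal_cost x y t s s' :
  perm_eq s s' -> minimal_cost x y t s -> minimal_cost x y t s'.
Proof.
move=> ss' hs s'' e; have := hs s''.
rewrite /total_cost /pair_sum !(perm_big s' ss') /=; exact.
Qed.

(** All three pairs cost their first entry times x, and positive first entries make superadditivity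
    strict. *)
Lemma minimal_cost_split x y t s e e1 e2 : 0 < x -> 1 < t ->
  minimal_cost x y t s -> e \in s ->
  e = (e1.1 + e2.1, e1.2 + e2.2)%N -> (0 < e1.1)%N -> (0 < e2.1)%N ->
  e1.2%:R * y <= e1.1%:R * x -> e2.2%:R * y <= e2.1%:R * x -> False.
Proof.
move=> x0 t1 hs es eE e10 e20 h1 h2.
have /(_ [:: e1, e2 & rem e s]) := perm_minimal_cost (perm_to_rem es) hs.
rewrite /total_cost /pair_sum !big_cons eE !addnA => /(_ erefl).
rewrite addrA lerD2r leNgt (cost_above h1) (cost_above h2) cost_above /=; last first.
  by rewrite !natrD !mulrDl lerD.
by rewrite natrD mulrDl powR_superadd // mulr_gt0 // ltr0n.
Qed.

(** If e = d (a, b) with d > 1, then e splits into (a, b) and (d - 1) (a, b), which lie on the same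
    side as e. *)
Lemma minimal_cost_coprime x y t s e : 0 < x -> 0 < y -> 1 < t ->
  minimal_cost x y t s -> e \in s -> above x y e -> coprime e.1 e.2.
Proof.
move=> x0 y0 t1 hs es ab; apply/negPn/negP => ncop.
have e10 : (0 < e.1)%N.
  rewrite lt0n; apply/negP => /eqP e0; move: ab; rewrite /above e0 mul0r.
  by rewrite ltNge mulr_ge0 // ltW.
have /dvdnP[a aE] := dvdn_gcdl e.1 e.2; have /dvdnP[b bE] := dvdn_gcdr e.1 e.2.
have d0 : (0 < gcdn e.1 e.2)%N by rewrite gcdn_gt0 e10.
set d := gcdn _ _ in aE bE d0 ncop.
have d1 : (1 < d)%N by move: ncop; rewrite /coprime -/d; lia.
have a0 : (0 < a)%N by case: a aE => [|//]; lia.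
have ab' : b%:R * y <= a%:R * x.
  have := ltW ab; rewrite aE bE !natrM -!mulrA ![d%:R * _]mulrC !mulrA.
  by rewrite ler_pM2r // ltr0n.
apply: (@minimal_cost_split x y t s e (a, b) (a * d.-1, b * d.-1)%N) => //=.
- by rewrite [LHS]surjective_pairing aE bE -!mulnS prednK.
- by rewrite muln_gt0 a0 /= -ltnS prednK.
- rewrite !natrM -!mulrA ![d.-1%:R * _]mulrC !mulrA.
  by rewrite ler_wpM2r.
Qed.

(** Moving one unit of the second entry from f to e keeps the cost of e, still determined by its
    first entry, and strictly lowers that of f. *)
Lemma minimal_cost_exchange x y t s e f : 0 < x -> 0 < y -> 0 < t ->
  minimal_cost x y t s -> e \in s -> f \in s ->
  above x y (e.1, e.2.+1) -> above y x (transpose f) -> False.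
Proof.
move=> x0 y0 t0 hs es fs; rewrite /above /= => he hf.
have he' : e.2%:R * y < e.1%:R * x.
  by apply: le_lt_trans he; rewrite ler_wpM2r ?ltW // ltr_nat.
(* One pair is above and the other below, so they are distinct entries and can be taken out of s
   together. *)
have nef : f != e by apply/eqP => fe; move: hf; rewrite fe => /(lt_trans he'); rewrite ltxx.
have fr : f \in rem e s.
  by move: fs; rewrite (perm_mem (perm_to_rem es)) inE (negPf nef).
have pm : perm_eq s [:: e, f & rem f (rem e s)].
  by rewrite (perm_trans (perm_to_rem es)) // perm_cons perm_to_rem.
have f20 : (0 < f.2)%N.
  rewrite lt0n; apply/negP => /eqP f0; move: hf; rewrite f0 mul0r.
  by rewrite ltNge mulr_ge0 // ltW.
have /(_ [:: (e.1, e.2.+1), (f.1, f.2.-1) & rem f (rem e s)]) :=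
  perm_minimal_cost pm hs.
rewrite /total_cost /pair_sum !big_cons /= addSn -addnS -addSn prednK // => /(_ erefl).
rewrite (cost_above (ltW he')) (@cost_above _ _ (e.1, e.2.+1) (ltW he)) /=.
rewrite lerD2l lerD2r leNgt.
apply/negP/negPn; apply: gt0_ltr_powR => //; rewrite ?nnegrE.
- by rewrite /cost le_max mulr_ge0 // ltW.
- by rewrite /cost le_max mulr_ge0 // ltW.
rewrite /cost gt_max !lt_max hf /= orbT /=; apply/orP; right.
by rewrite ltr_pM2r // ltr_nat prednK.
Qed.

Lemma minimal_cost_above x y t s e : 0 < x -> 0 < y -> 1 < t ->
  (forall f, f \in s -> above x y f \/ above y x (transpose f)) ->
  best_above x y (pair_sum s) \/ best_above y x (transpose (pair_sum s)) ->
  minimal_cost x y t s -> e \in s -> above x y e -> best_above x y e.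
Proof.
move=> x0 y0 t1 tot best hs es he.
split => //; first exact: minimal_cost_coprime hs es he.
move=> f fe hf; rewrite leqNgt; apply/negP => lt_ef.
have f10 : (0 < f.1)%N.
  rewrite lt0n; apply/negP => /eqP f0; move: hf; rewrite /above f0 mul0r.
  by rewrite ltNge mulr_ge0 // ltW.
have [le2|gt2] := leqP f.2 e.2.
  have lt1 : (f.1 < e.1)%N.
    by rewrite ltn_neqAle fe andbT; apply/eqP => fe1; move: lt_ef; rewrite fe1; nia.
  apply: (@minimal_cost_split x y t s e f (e.1 - f.1, e.2 - f.2)%N) => //=.
  - by rewrite !subnKC // -surjective_pairing.
  - by rewrite subn_gt0.
  - exact: ltW.
  (* The quotient of f is smaller than that of e, so that of e - f is no smaller than that of e;
     hence e - f is above too. *)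
  have e10 : 0 < e.1%:R :> R by rewrite ltr0n; lia.
  rewrite -(ler_pM2l e10) !mulrA -!natrM.
  apply: (@le_trans _ _ (((e.1 - f.1) * e.2)%:R * y)).
    by rewrite ler_wpM2r ?(ltW y0) // ler_nat; nia.
  rewrite natrM -mulrA [(e.1 * _)%N]mulnC natrM -[leRHS]mulrA.
  by rewrite ler_wpM2l // ltW.
(* If no element were below, the sum would be above, hence satisfy [best_above x y], and every
   element would have a quotient at least that of the sum. *)
have [g gs hg] : exists2 g, g \in s & above y x (transpose g).
  apply: contrapT => nex.
  have all_above g : g \in s -> above x y g.
    by move=> gs; case: (tot g gs) => // hg; case: nex; exists g.
  case: best => [[_ _ hmin]|[]]; last first.
    rewrite /above /= => + _ _.
    rewrite ltNge => /negP; apply.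
    rewrite !natr_sum !mulr_suml big_seq [leRHS]big_seq.
    by apply: ler_sum => g /all_above /ltW.
  have le1 g : g \in s -> (g.1 <= (pair_sum s).1)%N.
    by move=> gs; rewrite /= (big_rem g) //= leq_addr.
  have hle g : g \in s -> ((pair_sum s).1 * g.2 <= g.1 * (pair_sum s).2)%N.
    by move=> gs; apply: hmin; rewrite ?le1 ?all_above.
  (* As f competes with the sum too, the quotient of e, larger than that of f, strictly exceeds that
     of the sum. Adding the cross-multiplied inequalities over s gives a number smaller than
     itself. *)
  have := hmin f (leq_trans fe (le1 _ es)) hf.
  have : (\sum_(g <- rem e s) (pair_sum s).1 * g.2 <= \sum_(g <- rem e s) g.1 * (pair_sum s).2)%N.
    rewrite big_seq [leqRHS]big_seq; apply: leq_sum => g /mem_rem; exact: hle.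
  rewrite -big_distrr -big_distrl /=.
  rewrite !(big_rem e es) /=.
  set A := (\sum_(_ <- _) _)%N; set B := (\sum_(_ <- _) _)%N.
  have := leq_trans fe (le1 _ es); rewrite /= (big_rem e es) /= -/A.
  move: f10 lt_ef; clear; move: e.1 e.2 f.1 f.2 A B => *; nia.
(* There is room in e: (e.2 + 1) y <= f.2 y < f.1 x <= e.1 x. *)
apply: (minimal_cost_exchange x0 y0 _ hs es gs _ hg).
  exact: lt_trans t1.
rewrite /above /=; apply: le_lt_trans (lt_le_trans hf _).
  by rewrite ler_wpM2r ?(ltW y0) // ler_nat.
by rewrite ler_wpM2r ?(ltW x0) // ler_nat.
Qed.

Lemma transposeK : involutive transpose. Proof. by case. Qed.

Lemma pair_sum_swap s : pair_sum (map transpose s) = transpose (pair_sum s).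
Proof. by rewrite /pair_sum !big_map. Qed.

Lemma total_cost_swap x y t s : total_cost y x t (map transpose s) = total_cost x y t s.
Proof. by rewrite /total_cost big_map; apply: eq_bigr => e _; rewrite /cost maxC. Qed.

Lemma minimal_cost_swap x y t s :
  minimal_cost x y t s -> minimal_cost y x t (map transpose s).
Proof.
move=> hs s' s'E; rewrite total_cost_swap -(total_cost_swap y x); apply: hs.
by rewrite pair_sum_swap s'E pair_sum_swap transposeK.
Qed.

Lemma minimal_cost_best x y t s e : 0 < x -> 0 < y -> 1 < t ->
  (forall f, f \in s -> above x y f \/ above y x (transpose f)) ->
  best_above x y (pair_sum s) \/ best_above y x (transpose (pair_sum s)) ->
  minimal_cost x y t s -> e \in s ->
  best_above x y e \/ best_above y x (transpose e).
Proof.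
move=> x0 y0 t1 tot best hs es; have [he|he] := tot e es; [left|right].
  exact: minimal_cost_above hs es he.
apply: minimal_cost_above (minimal_cost_swap hs) (map_f _ es) he => //.
- by move=> _ /mapP[f fs ->]; rewrite transposeK or_comm; apply: tot.
- by rewrite pair_sum_swap transposeK or_comm.
Qed.

End Minimal.

(** * Finite places of the rational field *)

Lemma fieldExt_gen_ratr (K : fieldExtType rat) (x : K) (r : rat) :
  <<1; x>>%VS = fullv -> x = ratr r -> \dim {:K} = 1%N /\ forall y : K, exists c, y = ratr c.
Proof.
move=> gen xr.
have full1 : fullv = 1%VS :> {vspace K}.
  rewrite -gen; apply/eqP; rewrite eqEsubv sub_adjoin1v subv_adjoin andbT.
  by rewrite xr -alg_num_field; apply/vlineP; exists r.
split=> [|y]; first by rewrite full1 dimv1.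
have /vlineP[c ->] : y \in 1%VS by rewrite -full1 memvf.
by exists c; rewrite -alg_num_field.
Qed.

(** The field comes with an embedding into [algC] that sends the generator to r; injectivity makes
    the generator rational. *)
Lemma Qadj_ratr (r : rat) :
  [/\ \dim {:Qadj (ratr r)} = 1%N, Qadj_gen (ratr r) = ratr r &
    forall y : Qadj (ratr r), exists c, y = ratr c].
Proof.
rewrite /Qadj_gen /Qadj; case: num_field_exists => K [f [s fs gen]] /=.
case: s fs gen => [//|x [|//]] [fx].
rewrite adjoin_seq1 => gen.
have xr : x = ratr r by apply: (fmorph_inj f); rewrite fx fmorph_rat.
by have [] := fieldExt_gen_ratr gen xr.
Qed.

Section RatrFieldExt.
Variable K : fieldExtType rat.

Lemma ratr_fieldExt_inj : injective (ratr : rat -> K).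
Proof. by move=> c d; rewrite -!alg_num_field; apply: (fmorph_inj (in_alg K)). Qed.

Lemma ratr_fieldExtD c d : ratr (c + d) = ratr c + ratr d :> K.
Proof. by rewrite -!alg_num_field scalerDl. Qed.

Lemma ratr_fieldExtM c d : ratr (c * d) = ratr c * ratr d :> K.
Proof. by rewrite -!alg_num_field -scalerAl mul1r scalerA. Qed.

Lemma ratr_fieldExt_eq0 c : (ratr c == 0 :> K) = (c == 0).
Proof. by rewrite -alg_num_field scaler_eq0 oner_eq0 orbF. Qed.

Lemma ratr_fieldExt0 : ratr 0 = 0 :> K.
Proof. by apply/eqP; rewrite ratr_fieldExt_eq0. Qed.

End RatrFieldExt.

(** * Elementary properties of a finite place *)

Section Valuations.
Context {K : fieldExtType rat} {v : K -> int}.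
Hypothesis vP : finite_places v.

Lemma place0 : v 0 = 0. Proof. by have [] := vP. Qed.

Lemma placeM x y : x != 0 -> y != 0 -> v (x * y) = v x + v y.
Proof. by have [_ + _ _] := vP; apply. Qed.

Lemma place1 : v 1 = 0.
Proof. by have := placeM (oner_neq0 K) (oner_neq0 K); rewrite mulr1; move: (v 1) => w; lia. Qed.

Lemma placeN x : v (- x) = v x.
Proof.
have N1 : -1 != 0 :> K by rewrite oppr_eq0 oner_neq0.
have := placeM N1 N1; rewrite mulrNN mulr1 place1 => vN1.
have [->|x0] := eqVneq x 0; first by rewrite oppr0.
by rewrite -mulN1r placeM //; lia.
Qed.

Lemma placeV x : v x^-1 = - v x.
Proof.
have [->|x0] := eqVneq x 0; first by rewrite invr0 place0.
have := placeM x0; move/(_ x^-1).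
by rewrite divff // place1 invr_eq0 => /(_ x0); move: (v x) (v _) => w w'; lia.
Qed.

Lemma placeX x n : x != 0 -> v (x ^+ n) = n%:Z * v x.
Proof.
move=> x0; elim: n => [|n IHn]; first by rewrite expr0 place1 mul0r.
by rewrite exprS placeM ?expf_neq0 // IHn; lia.
Qed.

Lemma valuation_idealD x y :
  valuation_ideal v x -> valuation_ideal v y -> valuation_ideal v (x + y).
Proof.
have [_ _ vD _] := vP.
move=> [->|vx]; first by rewrite add0r.
move=> [->|vy]; first by rewrite addr0; right.
have [xy0|xy0] := eqVneq (x + y) 0; first by left.
have nz z : 0 < v z -> z != 0 by apply: contraTneq => ->; rewrite place0 ltxx.
by right; apply: lt_le_trans (vD _ _ (nz _ vx) (nz _ vy) xy0); rewrite lt_min vx.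
Qed.

Lemma valuation_idealN x : valuation_ideal v x -> valuation_ideal v (- x).
Proof.
by move=> [->|vx]; [left; rewrite oppr0|right; rewrite placeN].
Qed.

Lemma valuation_ideal_natM n x : valuation_ideal v x -> valuation_ideal v (n%:R * x).
Proof.
move=> vx; elim: n => [|n IHn]; first by left; rewrite mul0r.
by rewrite -natr1 mulrDl mul1r; apply: valuation_idealD.
Qed.

Lemma valuation_ideal1 : ~ valuation_ideal v 1.
Proof.
move=> [/eqP|]; first by rewrite oner_eq0.
by rewrite place1.
Qed.

Lemma natr_fieldExt_eq0 n : (n%:R == 0 :> K) = (n == 0)%N.
Proof. by rewrite -ratr_nat ratr_fieldExt_eq0 pnatr_eq0. Qed.

Lemma place_nat_ge0 n : 0 <= v n%:R.
Proof.
have [_ _ vD _] := vP.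
elim: n => [|n IHn]; first by rewrite place0.
have [->|n0] := eqVneq n 0%N; first by rewrite place1.
rewrite -natr1; apply: le_trans (vD _ _ _ _ _).
- by rewrite le_min IHn place1.
- by rewrite natr_fieldExt_eq0.
- exact: oner_neq0.
- by rewrite natr1 natr_fieldExt_eq0.
Qed.

(** Were v positive at m as well, Bezout would put 1 = a q - b m in the valuation ideal. *)
Lemma place_coprime q m : 0 < v q%:R -> coprime q m -> v m%:R = 0.
Proof.
move=> vq cop; apply/eqP; rewrite eq_le place_nat_ge0 andbT leNgt; apply/negP => vm.
have q0 : (0 < q)%N by case: (q) vq => [|//]; rewrite place0.
case: (egcdnP m q0) => a b; rewrite (eqP cop) => abE _; apply: valuation_ideal1.
have -> : 1 = a%:R * q%:R + - (b%:R * m%:R) :> K.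
  by rewrite -!natrM abE natrD addrAC subrr add0r.
apply: valuation_idealD; last apply: valuation_idealN.
  by apply: valuation_ideal_natM; right.
by apply: valuation_ideal_natM; right.
Qed.

(** Write n = m q^k with m prime to q, so that v vanishes at m. For n = 0 both sides are the default
    value 0. *)
Lemma place_natE q n : prime q -> 0 < v q%:R -> v n%:R = (logn q n)%:Z * v q%:R.
Proof.
move=> pq vq; have [->|] := posnP n; first by rewrite place0 logn0 mul0r.
move=> n0; have [m cop nE] := pfactor_coprime pq n0.
rewrite {1}nE natrM natrX placeM; last 2 first.
- rewrite natr_fieldExt_eq0; apply: contraTneq cop => ->.
  by rewrite /coprime gcdn0; case: q pq {vq nE} => [|[]].
- by rewrite expf_neq0 // natr_fieldExt_eq0 -lt0n prime_gt0.
rewrite (place_coprime vq cop) placeX ?add0r // natr_fieldExt_eq0 -lt0n.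
exact: prime_gt0.
Qed.

End Valuations.

(** The q-adic valuation; its value 0 at c = 0 agrees with the dummy value in [finite_places]. *)
Definition padic (q : nat) (c : rat) : int :=
  (logn q `|numq c|)%:Z - (logn q `|denq c|)%:Z.

Lemma ratr_num_den (F : fieldExtType rat) (c : rat) :
  ratr c = (numq c)%:~R / (denq c)%:~R :> F.
Proof. by []. Qed.

Lemma place_ratr (K : fieldExtType rat) (v : K -> int) q c :
  finite_places v -> prime q -> 0 < v q%:R -> v (ratr c) = padic q c * v q%:R.
Proof.
move=> vP pq vq.
have vint (m : int) : v m%:~R = (logn q `|m|)%:Z * v q%:R.
  case: m => m; first by rewrite -[(Posz m)%:~R]/(m%:R) (place_natE vP m pq vq).
  by rewrite NegzE mulrNz placeN // abszN -[(Posz _)%:~R]/(m.+1%:R) (place_natE vP m.+1 pq vq).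
have [->|c0] := eqVneq c 0; first by rewrite ratr_fieldExt0 place0 // /padic logn0 logn1 mul0r.
rewrite ratr_num_den placeM // ?placeV // ?vint; first by rewrite /padic; ring.
  by rewrite -ratr_int ratr_fieldExt_eq0 intr_eq0 numq_eq0.
by rewrite invr_eq0 -ratr_int ratr_fieldExt_eq0 intr_eq0 denq_neq0.
Qed.

(** The fraction m / n need not be reduced: compare the exponents of q in
    [numq c * n = m * denq c]. *)
Lemma padic_frac q (m n : int) : m != 0 -> n != 0 ->
  padic q (m%:~R / n%:~R) = (logn q `|m|)%:Z - (logn q `|n|)%:Z.
Proof.
move=> m0 n0; set c := _ / _.
have c0 : c != 0 by rewrite mulf_neq0 ?invr_eq0 ?intr_eq0.
have : numq c * n = m * denq c.
  apply: (@intr_inj rat); rewrite !rmorphM /=; apply/eqP.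
  rewrite -eqr_div ?intr_eq0 ?denq_neq0 //.
  by rewrite divq_num_den.
move=> /(congr1 (fun z => logn q `|z|)); rewrite !abszM !lognM ?absz_gt0 ?numq_eq0 ?denq_neq0 //.
by rewrite /padic; lia.
Qed.

Lemma rat_fracP (c : rat) : exists m n : int, n != 0 /\ c = m%:~R / n%:~R.
Proof. by exists (numq c), (denq c); rewrite denq_neq0 divq_num_den. Qed.

Lemma padicM q c d : c != 0 -> d != 0 -> padic q (c * d) = padic q c + padic q d.
Proof.
have [m [n [n0 ->]]] := rat_fracP c; have [m' [n' [n'0 ->]]] := rat_fracP d.
rewrite !mulf_eq0 !invr_eq0 !intr_eq0 (negPf n0) (negPf n'0) !orbF => m0 m'0.
rewrite mulf_div -!rmorphM /= !padic_frac ?mulf_neq0 // !abszM !lognM ?absz_gt0 //.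
by lia.
Qed.

Lemma logn_addz q (m n : int) : prime q -> m + n != 0 -> m != 0 -> n != 0 ->
  (minn (logn q `|m|) (logn q `|n|) <= logn q `|(m + n)%R|)%N.
Proof.
move=> pq mn0 m0 n0; rewrite -pfactor_dvdn ?absz_gt0 //.
set k := minn _ _.
have -> : (q ^ k)%N = `|(q ^ k)%N : int|%N by [].
rewrite -dvdzE; apply: rpredD; rewrite dvdzE /= pfactor_dvdn ?absz_gt0 //.
  exact: geq_minl.
exact: geq_minr.
Qed.

Lemma padicD q c d : prime q -> c != 0 -> d != 0 -> c + d != 0 ->
  Num.min (padic q c) (padic q d) <= padic q (c + d).
Proof.
have [m [n [n0 ->]]] := rat_fracP c; have [m' [n' [n'0 ->]]] := rat_fracP d.
move=> pq; rewrite addf_div ?intr_eq0 // -!rmorphM -rmorphD /=.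
rewrite !mulf_eq0 !invr_eq0 !intr_eq0 mulf_eq0 (negPf n0) (negPf n'0) !orbF => m0 m'0 s0.
rewrite !padic_frac ?mulf_neq0 //.
have := logn_addz pq s0; rewrite !mulf_neq0 // => /(_ isT isT).
rewrite !abszM !lognM ?absz_gt0 //.
move: (logn _ _) (logn _ _) (logn _ _) (logn _ _) (logn _ _) => *.
rewrite ge_min; lia.
Qed.

(* Meant for rational x only: every other x gets the junk value padic q 0 = 0. *)
Definition padic_place (K : fieldExtType rat) (q : nat) (x : K) : int :=
  padic q (xget 0 [set c | ratr c = x]).

Lemma padic_place_ratr (K : fieldExtType rat) q c : padic_place q (ratr c : K) = padic q c.
Proof.
rewrite /padic_place; congr padic; apply: xget_unique => // d; exact: ratr_fieldExt_inj.
Qed.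

Lemma padic_nat q n : padic q n%:R = (logn q n)%:Z.
Proof.
have [->|n0] := eqVneq n 0%N; first by rewrite /padic !logn0 !logn1.
by have := @padic_frac q n 1; rewrite divr1 /= logn1 subr0 => ->; rewrite // intr_eq0.
Qed.

(** * The q-adic place of a field whose elements are all rational *)

Section RationalField.
Variable K : fieldExtType rat.
Hypothesis ratK : forall y : K, exists c, y = ratr c.

Lemma finite_place_padic q : prime q -> finite_places (padic_place q : K -> int).
Proof.
move=> pq; split.
- by rewrite -ratr_fieldExt0 padic_place_ratr /padic logn0 logn1.
- move=> x y; have [c ->] := ratK x; have [d ->] := ratK y.
  rewrite -ratr_fieldExtM !padic_place_ratr !ratr_fieldExt_eq0; exact: padicM.
- move=> x y; have [c ->] := ratK x; have [d ->] := ratK y.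
  rewrite -ratr_fieldExtD !padic_place_ratr !ratr_fieldExt_eq0; exact: padicD.
exists q%:R; first by rewrite natr_fieldExt_eq0 -lt0n prime_gt0.
by rewrite -ratr_nat padic_place_ratr padic_nat logn_prime ?eqxx.
Qed.

(** On rationals v is the q-adic valuation times its value at q; as v takes the value 1, this
    positive factor divides 1. *)
Lemma finite_place_eq_padic q (v : K -> int) :
  prime q -> finite_places v -> 0 < v q%:R -> v = padic_place q.
Proof.
move=> pq vP vq; have [_ _ _ [x _ vx]] := vP.
have vE := place_ratr _ vP pq vq.
have v1 : v q%:R = 1.
  have [c xE] := ratK x; move: vx; rewrite xE vE.
  move: vq; move: (v _) (padic _ _) => a b a0 ba.
  by have [b0|b0] := ltrP b 1; move: a0 ba b0; clear; nia.
apply/funext => y; have [c ->] := ratK y.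
by rewrite padic_place_ratr vE v1 mulr1.
Qed.

Lemma padic_ge0_denq q c : prime q -> 0 <= padic q c -> coprime q `|denq c|.
Proof.
move=> pq c_ge0; rewrite prime_coprime //; apply/negP => qd.
have qn : ~~ (q %| `|numq c|)%N.
  apply/negP => qn; have := prime_gt1 pq.
  have : (q %| gcdn `|numq c| `|denq c|)%N by rewrite dvdn_gcd qn.
  by rewrite (eqP (coprime_num_den c)) dvdn1 => /eqP ->.
move: c_ge0; rewrite /padic logn_coprime ?prime_coprime //.
have : (0 < logn q `|denq c|)%N.
  by rewrite logn_gt0 mem_primes pq qd absz_gt0 denq_neq0.
lia.
Qed.

Lemma padic_residue_rep q (x : K) : prime q -> valuation_ring (padic_place q) x ->
  exists2 i, (i < q)%N & valuation_ideal (padic_place q) (x - i%:R).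
Proof.
move=> pq [->|]; first by exists 0%N; rewrite ?prime_gt0 // subrr; left.
have [c ->] := ratK x; rewrite padic_place_ratr => /(padic_ge0_denq pq) cop.
set n := numq c; set d := denq c in cop *.
have q0 : (q%:Z != 0)%R by rewrite eqz_nat -lt0n prime_gt0.
have /coprimezP[[u w] /= uw] : coprimez q d by [].
(* By the Bezout relation w inverts d modulo q, so i represents n / d modulo q. *)
pose i := ((n * w) %% q%:Z)%Z.
have i_ge0 : 0 <= i by apply: modz_ge0.
have iE : i = `|i|%N by rewrite gez0_abs.
exists `|i|%N.
  by rewrite -ltz_nat -iE ltz_pmod // ltz_nat prime_gt0.
set e := c - `|i|%:R.
have -> : ratr c - `|i|%:R = ratr e :> K.
  by rewrite ratr_fieldExtD -!alg_num_field scaleNr !alg_num_field ratr_nat.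
have [->|e0] := eqVneq e 0; first by left; rewrite ratr_fieldExt0.
right; rewrite padic_place_ratr.
have d0 : d != 0 by apply: denq_neq0.
have eE : e = (n - i * d)%:~R / d%:~R.
  rewrite /e -[c in LHS]divq_num_den iE rmorphB rmorphM /= mulrBl mulfK ?intr_eq0 //.
move: e0; rewrite eE mulf_eq0 invr_eq0 !intr_eq0 (negPf d0) orbF => m0.
rewrite padic_frac // (logn_coprime cop) subr0 ltz_nat logn_gt0 mem_primes pq absz_gt0 m0.
have : (q%:Z %| n - i * d)%Z; last by rewrite dvdzE.
have -> : n - i * d = q%:Z * (n * u + (n * w %/ q%:Z)%Z * d).
  have := divz_eq (n * w) q%:Z; rewrite -/i => nw.
  have : n = n * (u * q%:Z + w * d) by rewrite uw mulr1.
  move: nw; move: (_ %/ _)%Z => k nw nE; rewrite [n in LHS]nE.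
  by rewrite mulrDr [n * (w * d)]mulrA nw; ring.
exact: dvdz_mulr.
Qed.

(** The residue field is Z/q: the classes of 0, ..., q - 1 exhaust it, and they differ because q
    divides no positive integer below q. *)
Lemma place_norm_padic q : prime q -> place_norm (padic_place q : K -> int) = q.
Proof.
move=> pq; have vP := finite_place_padic pq.
set v := padic_place q in vP *.
pose h (i : nat) : set K := [set y | valuation_ideal v (y - i%:R)].
have inj_h : {in `I_q &, injective h}.
  move=> i j; rewrite !inE /= => iq jq hij.
  wlog ij : i j iq jq hij / (i <= j)%N.
    by move=> wl; have [/wl|/ltnW/wl] := leqP i j; [apply|move=> ->].
  have : h i j%:R by rewrite hij /h /= subrr; left.
  rewrite /h /= -natrB // => -[/eqP|].
    by rewrite natr_fieldExt_eq0; lia.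
  rewrite -ratr_nat /v padic_place_ratr padic_nat ltz_nat.
  rewrite logn_gt0 mem_primes => /and3P[_ ji0 /dvdn_leq]; move: ji0; lia.
have eq_classes : residue_classes v = h @` `I_q.
  apply/seteqP; split=> [_ [x xv <-]|_ [i _ <-]]; last first.
    exists i%:R => //; right; exact: place_nat_ge0.
  have [i iq xi] : exists2 i, (i < q)%N & valuation_ideal v (x - i%:R).
    exact: padic_residue_rep.
  exists i => //; apply/seteqP; split=> y; rewrite /h /= => yi.
    have -> : y - x = y - i%:R + - (x - i%:R) by ring.
    by apply: (valuation_idealD vP) => //; apply: (valuation_idealN vP).
  have -> : y - i%:R = y - x + (x - i%:R) by ring.
  exact: (valuation_idealD vP).
by apply: card_fset_set; rewrite eq_classes; apply: inj_card_eq.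
Qed.

End RationalField.

(** * Mahler measure of p^a / q^b *)

Section WeilHeightRational.
Variables (R : realType) (K : fieldExtType rat).
Hypothesis ratK : forall y : K, exists c, y = ratr c.

(** Reads x as a rational number; a non-rational x would be sent to 0. *)
Definition rat_embedding (x : K) : R[i] := ratr (xget 0 [set c | ratr c = x]).

Lemma rat_embedding_ratr c : rat_embedding (ratr c) = ratr c.
Proof.
rewrite /rat_embedding; congr ratr; apply: xget_unique => // d; exact: ratr_fieldExt_inj.
Qed.

Lemma embeddings_ratr : @embeddings R K = [set rat_embedding].
Proof.
apply/seteqP; split=> s /=.
  move=> [sB sM].
  pose f : {rmorphism K -> R[i]} := HB.pack s
    (GRing.isZmodMorphism.Build _ _ s sB) (GRing.isMonoidMorphism.Build _ _ s sM).
  apply/funext => x; have [c ->] := ratK x.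
  by rewrite rat_embedding_ratr; apply: (fmorph_rat f).
move=> ->; split=> [x y|].
  have [c ->] := ratK x; have [d ->] := ratK y.
  have -> : ratr c - ratr d = ratr (c - d) :> K.
    by rewrite ratr_fieldExtD -!alg_num_field scaleNr.
  by rewrite !rat_embedding_ratr rmorphB.
split=> [|x y].
  have -> : 1 = ratr 1%N%:R :> K by rewrite ratr_nat.
  by rewrite rat_embedding_ratr rmorph1.
have [c ->] := ratK x; have [d ->] := ratK y.
by rewrite -ratr_fieldExtM !rat_embedding_ratr rmorphM.
Qed.

Lemma normc_ratr (c : rat) : Normc.normc (ratr c : R[i]) = `|ratr c : R|.
Proof.
have -> : ratr c = (ratr c : R)%:C%C by rewrite fmorph_rat.
by rewrite /= expr0n addr0 sqrtr_sqr.
Qed.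

Lemma log_plus_le1 (x : R) : x <= 1 -> log_plus x = 0.
Proof. by move=> x1; rewrite /log_plus max_l // ln1. Qed.

Lemma place_abs_ge0 (v : K -> int) x : 0 <= v x -> place_abs R v x <= 1.
Proof.
rewrite /place_abs; case: eqP => // _; case: (v x) => // n _.
(* For an arbitrary v the residue classes are not known here to be finite; an infinite set would
   give norm 0, and the bound holds then too. *)
rewrite -exprnN; have [->|] := posnP (place_norm v).
  by rewrite -exprVn invr0 expr0n; case: eqP.
by move=> N0; rewrite invf_le1 ?exprn_ege1 ?exprn_gt0 ?ltr0n ?ler1n.
Qed.

Lemma padic_prime_ratio p q a b : prime p -> prime q -> p <> q ->
  padic q (nat_frac (p ^ a, q ^ b)%N) = - b%:Z.
Proof.
move=> pp pq pNq.
rewrite (_ : nat_frac _ = (Posz (p ^ a))%:~R / (Posz (q ^ b))%:~R) //.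
rewrite padic_frac ?eqz_nat -?lt0n ?expn_gt0 ?prime_gt0 //=.
rewrite !lognX !logn_prime // eqxx; case: eqP => [/esym//|_]; rewrite muln0 muln1; lia.
Qed.

Lemma ratr_prime_ratio p q a b : prime q ->
  ratr (nat_frac (p ^ a, q ^ b)%N) = p%:R ^+ a / q%:R ^+ b :> K.
Proof.
move=> pq.
have B0 : (q ^ b)%:R != 0 :> rat by rewrite pnatr_eq0 expn_eq0 negb_and -lt0n prime_gt0.
apply: (canRL (mulfK _)); first by rewrite expf_neq0 // natr_fieldExt_eq0 -lt0n prime_gt0.
by rewrite -!natrX -!(ratr_nat K) -ratr_fieldExtM divfK.
Qed.

Lemma ln_max (x y : R) : 0 < x -> 0 < y -> ln (Num.max x y) = Num.max (ln x) (ln y).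
Proof.
move=> x0 y0; have [xy|/ltW yx] := leP x y; first by rewrite max_r // ler_ln.
by rewrite max_l // ler_ln.
Qed.

(** The factor [\dim {:K}] cancels the normalization. The embedding contributes log max(1, p^a /
    q^b) and the q-adic place log q^b, which add up to log max(p^a, q^b). *)
Lemma weil_height_in_prime_ratio p q a b (c := nat_frac (p ^ a, q ^ b)%N) :
  prime p -> prime q -> p <> q ->
  weil_height_in R (ratr c : K) * (\dim {:K})%:R = Num.max (a%:R * ln p%:R) (b%:R * ln q%:R).
Proof.
move=> pp pq pNq.
have p0 : 0 < p%:R :> R by rewrite ltr0n prime_gt0.
have q0 : 0 < q%:R :> R by rewrite ltr0n prime_gt0.
have c0 : c != 0 by rewrite mulf_neq0 ?invr_eq0 ?pnatr_eq0 -?lt0n ?expn_gt0 ?prime_gt0.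
rewrite /weil_height_in mulfVK; last by rewrite pnatr_eq0 -lt0n adim_gt0.
rewrite embeddings_ratr fsbig_set1 rat_embedding_ratr normc_ratr.
rewrite -(fsbig_widen [set padic_place q] (@finite_places K)); last 2 first.
- by move=> _ ->; apply: finite_place_padic.
- move=> v [vP vNq] /=; apply: log_plus_le1; apply: place_abs_ge0.
  (* A place other than the q-adic one vanishes at q, hence is nonnegative at p^a / q^b and
     contributes nothing. *)
  have vq0 : v q%:R = 0.
    apply/eqP; rewrite eq_le (place_nat_ge0 vP) andbT leNgt; apply/negP => vq.
    by apply: vNq; apply: finite_place_eq_padic.
  have n0 n : prime n -> n%:R != 0 :> K by rewrite natr_fieldExt_eq0 -lt0n; apply: prime_gt0.
  rewrite ratr_prime_ratio // placeM ?invr_eq0 ?expf_neq0 ?n0 // placeV // !placeX ?n0 //.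
  by rewrite vq0 mulr0 subr0 mulr_ge0 // place_nat_ge0.
rewrite fsbig_set1 /place_abs ratr_fieldExt_eq0 (negPf c0).
rewrite place_norm_padic // padic_place_ratr padic_prime_ratio // opprK.
have ratrc : ratr c = p%:R ^+ a / q%:R ^+ b :> R.
  by rewrite /c /nat_frac fmorph_div /= !ratr_nat !natrX.
rewrite ratrc ger0_norm; last by rewrite divr_ge0 // exprn_ge0 // ltW.
rewrite /log_plus -[_ ^ b%:Z]/(_ ^+ b).
have qb : 1 <= q%:R ^+ b :> R by rewrite exprn_ege1 // ler1n prime_gt0.
rewrite [in X in _ + X]max_r // -lnM ?posrE; last 2 first.
- by rewrite lt_max ltr01.
- exact: lt_le_trans qb.
rewrite (maxr_pMl) ?(le_trans _ qb) // mul1r divfK; last by rewrite gt_eqF ?(lt_le_trans _ qb).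
rewrite !mulr_natl -!lnXn // maxC ln_max ?exprn_gt0 //.
Qed.

End WeilHeightRational.

Lemma mahler_prime_ratio (R : realType) p q a b : prime p -> prime q -> p <> q ->
  mahler R (ratr (nat_frac (p ^ a, q ^ b)%N)) = Num.max (a%:R * ln p%:R) (b%:R * ln q%:R).
Proof.
move=> pp pq pNq; rewrite /mahler /weil_height mulrC.
have [_ -> ratK] := Qadj_ratr (nat_frac (p ^ a, q ^ b)%N).
exact: weil_height_in_prime_ratio.
Qed.

(** * Best approximations and attained infima *)

Section BestAbove.
Variable R : realType.
Variables (x y : R).
Hypotheses (x0 : 0 < x) (y0 : 0 < y).

Lemma above_NN e : above x y e -> NN e.
Proof. by move=> + e0; rewrite e0 /above /= !mul0r ltxx. Qed.

Lemma UU_above e : UU (y / x) e <-> above x y e.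
Proof.
rewrite /UU /above /= mulrA ltr_pdivrMr //; split=> [[]//|he].
by split=> //; apply: above_NN.
Qed.

Lemma LL_above e : LL (y / x) e <-> above y x (transpose e).
Proof.
rewrite /LL /above /= mulrA ltr_pdivlMr //; split=> [[]//|he].
by split=> // e0; move: he; rewrite e0 /= !mul0r ltxx.
Qed.

(** When e.2 = 0, membership in [NN] gives e.1 > 0, so the cross-multiplied inequality fails against
    any finite quotient, as it must for +oo. *)
Lemma le_quot e f : NN e ->
  (quot R e <= quot R f)%E = (e.1 * f.2 <= f.1 * e.2)%N.
Proof.
move=> eNN; rewrite /quot.
have [e2|e2] := eqVneq e.2 0%N; have [f2|f2] := eqVneq f.2 0%N.
- by rewrite lexx e2 f2 !muln0.
- rewrite e2 muln0 leqn0 muln_eq0 (negPf f2) orbF; apply/esym/negbTE/eqP => e1.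
  by apply: eNN; rewrite [e]surjective_pairing e1 e2.
- by rewrite leey f2 muln0.
rewrite lee_fin ler_pdivrMr ?ltr0n ?lt0n // mulrAC ler_pdivlMr ?ltr0n ?lt0n //.
by rewrite -!natrM ler_nat.
Qed.

Lemma upper_best_above e : upper_best_approx (y / x) e <-> best_above x y e.
Proof.
split.
  move=> [[_ /= cop] [/UU_above he [_ lb]]]; split=> //; first exact/eqP.
  move=> f fe hf; rewrite -le_quot; last exact: above_NN he.
  apply: lb.
  by exists f => //; split=> //; apply/UU_above.
move=> [he cop lb]; split; [split; [exact: above_NN|exact/eqP]|split; first exact/UU_above].
split; first by exists e => //; split=> //; apply/UU_above.
by move=> _ [f [/UU_above hf fe] <-]; rewrite le_quot; [apply: lb|apply: above_NN he].
Qed.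

(** Maximizing a / b under a bound on b amounts to minimizing b / a, which is the upper problem for
    the transposed pairs. *)
Lemma lower_best_above e :
  lower_best_approx (y / x) e <-> best_above y x (transpose e).
Proof.
have mulC f : (f.1 * e.2 <= e.1 * f.2)%N = (e.2 * f.1 <= f.2 * e.1)%N.
  by rewrite mulnC [(e.1 * _)%N]mulnC.
split.
  move=> [[_ /= cop] [/LL_above he [_ ub]]]; split=> //=.
    by rewrite coprime_sym; apply/eqP.
  move=> f fe hf; rewrite -(mulC (transpose f)) -le_quot; first apply: ub.
    by exists (transpose f) => //; split=> //; apply/LL_above; rewrite transposeK.
  by have [] : LL (y / x) (transpose f) by apply/LL_above; rewrite transposeK.
move=> [he cop lb]; have [eNN eL] := (LL_above e).2 he.
split; [split=> //; apply/eqP; rewrite -/(coprime _ _) coprime_sym //|split=> //].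
split; first by exists e => //; split.
move=> _ [f [fL fe] <-]; rewrite le_quot; last by case: fL.
by rewrite mulC; apply: (lb (transpose f)) => //; apply/LL_above.
Qed.
End BestAbove.

(** * From product representations to lists of pairs *)

Lemma prod_prime_ratio p q s :
  \prod_(z <- algC_seq [seq nat_frac (p ^ e.1, q ^ e.2)%N | e <- s]) z =
  ratr (nat_frac (p ^ (pair_sum s).1, q ^ (pair_sum s).2)%N).
Proof.
rewrite /algC_seq !big_map -rmorph_prod /=; congr ratr.
rewrite /nat_frac /pair_sum /= big_split /= prodfV !expn_sum !natr_prod //.
Qed.

Lemma prime_ratio_inj p q a b a' b' : prime p -> prime q -> p <> q ->
  nat_frac (p ^ a, q ^ b)%N = nat_frac (p ^ a', q ^ b')%N -> (a, b) = (a', b').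
Proof.
move=> pp pq pNq eqf.
have nz r n : prime r -> (r ^ n)%:R != 0 :> rat.
  by move=> pr; rewrite pnatr_eq0 expn_eq0 negb_and -lt0n prime_gt0.
move/eqP: eqf; rewrite /nat_frac /= eqr_div ?nz // -!natrM eqr_nat => /eqP eqN.
have pe r n : prime r -> (0 < r ^ n)%N by move=> pr; rewrite expn_gt0 prime_gt0.
congr (_, _).
  have := congr1 (logn p) eqN; rewrite !lognM ?pe // !lognX !logn_prime // eqxx.
  by case: eqP pNq => // _ _; lia.
have := congr1 (logn q) eqN; rewrite !lognM ?pe // !lognX !logn_prime // eqxx.
by rewrite eq_sym; case: eqP pNq => // _ _; lia.
Qed.

(** This is the irrationality of log q / log p: a tie would give p^a = q^b, so p^a / q^b = 1 and (a,
    b) = (0, 0). *)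
Lemma prime_powers_above (R : realType) p q e : prime p -> prime q -> p <> q -> NN e ->
  above (ln p%:R : R) (ln q%:R) e \/ above (ln q%:R : R) (ln p%:R) (transpose e).
Proof.
move=> pp pq pNq eNN; rewrite /above /=; case: ltgtP => [|| eqe]; [by left|by right|].
have pos r n : prime r -> 0 < r%:R ^+ n :> R.
  by move=> pr; rewrite exprn_gt0 // ltr0n prime_gt0.
case: eNN; rewrite [e]surjective_pairing.
apply: (@prime_ratio_inj p q e.1 e.2 0 0) => //.
have /eqP : p%:R ^+ e.1 == q%:R ^+ e.2 :> R.
  rewrite -(inj_in_eq (@ln_inj R)) ?posrE ?pos // !lnXn ?ltr0n ?prime_gt0 //.
  by move: eqe; rewrite !mulr_natl => ->.
rewrite -!natrX => /eqP; rewrite eqr_nat /nat_frac /= => /eqP ->.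
by rewrite !expn0 divr1 divff // pnatr_eq0 expn_eq0 negb_and -lt0n prime_gt0.
Qed.

Lemma rep_value_prime_ratio (R : realType) (t : R) p q s :
  prime p -> prime q -> p <> q ->
  rep_value t (algC_seq [seq nat_frac (p ^ e.1, q ^ e.2)%N | e <- s]) =
  total_cost (ln p%:R) (ln q%:R) t s `^ t^-1.
Proof.
move=> pp pq pNq; rewrite /rep_value /algC_seq /total_cost !big_map; congr (_ `^ _).
by apply: eq_bigr => e _; rewrite mahler_prime_ratio.
Qed.

(** Every list of pairs with the same sum yields another product representation of [alpha], and
    z^(1/t) is strictly increasing, so comparing values compares total costs. *)
Lemma attains_inf_minimal_cost (R : realType) (t : R) p q s alpha :
  prime p -> prime q -> p <> q -> 0 < t -> pair_sum s <> (0, 0)%N ->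
  attains_inf t alpha (algC_seq [seq nat_frac (p ^ e.1, q ^ e.2)%N | e <- s]) ->
  minimal_cost (ln p%:R) (ln q%:R) t s.
Proof.
move=> pp pq pNq t0 s0 [[_ _ prods] infs] s' s'E.
set f := fun e : nat * nat => nat_frac (p ^ e.1, q ^ e.2)%N in prods infs *.
have rep' : product_rep alpha (algC_seq (map f s')).
  split.
  (* A representation must be nonempty; the empty list is ruled out by its sum (0, 0). *)
  - by case: s' s'E => // s'E; case: s0; rewrite -s'E /pair_sum !big_nil.
  - apply/allP => _ /mapP[_ /mapP[e _ ->] ->].
    by rewrite fmorph_eq0 mulf_neq0 ?invr_eq0 // pnatr_eq0 expn_eq0 negb_and -lt0n prime_gt0.
  - by rewrite prod_prime_ratio s'E -prod_prime_ratio.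
have le_val : rep_value t (algC_seq (map f s)) <= rep_value t (algC_seq (map f s')).
  rewrite infs; apply: ge_inf; last by exists (algC_seq (map f s')).
  by exists 0 => _ [r _ <-]; apply: powR_ge0.
rewrite !rep_value_prime_ratio // in le_val.
rewrite leNgt; apply/negP => lt_cost; move: le_val; rewrite leNgt => /negP; apply.
have tot0 r : 0 <= total_cost (ln p%:R : R) (ln q%:R) t r.
  by apply: sumr_ge0 => e _; apply: powR_ge0.
by apply: gt0_ltr_powR; rewrite ?nnegrE ?invr_gt0.
Qed.

Local Close Scope classical_set_scope.
Unset Implicit Arguments.

Theorem theorem3p2 (R : realType) (p q : nat) (xi : R) (a b : nat)
    (alpha : rat) (N : nat) (ab : N.-tuple (nat * nat)) (t : R) :
  prime p -> prime q -> p <> q ->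
  xi = ln q%:R / ln p%:R ->
  upper_best_approx xi (a, b) \/ lower_best_approx xi (a, b) ->
  alpha = nat_frac (p ^ a, q ^ b)%N ->
  (forall n : 'I_N, NN (tnth ab n)) ->
  let s := [seq nat_frac (p ^ x.1, q ^ x.2)%N | x <- ab] in
  factorization alpha s ->
  1 < t ->
  attains_inf t (ratr alpha) (algC_seq s) ->
  forall n : 'I_N,
    upper_best_approx xi (tnth ab n) \/ lower_best_approx xi (tnth ab n).
Proof.
move=> pp pq pNq -> best alphaE abNN s _ t1 attains n.
have ln0 r : prime r -> 0 < ln (r%:R : R) by move=> pr; rewrite ln_gt0 // ltr1n prime_gt1.
(* Unique factorization recovers the exponents from the product. *)
have sumE : pair_sum ab = (a, b).
  case: attains => -[_ _]; rewrite prod_prime_ratio alphaE => + _.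
  by move/fmorph_inj/(prime_ratio_inj pp pq pNq); case: (pair_sum ab).
have s0 : pair_sum ab <> (0, 0)%N.
  by rewrite sumE; case: best => -[[]].
have tot e : e \in ab ->
    above (ln p%:R : R) (ln q%:R) e \/ above (ln q%:R : R) (ln p%:R) (transpose e).
  by move=> /tnthP[i ->]; apply: prime_powers_above.
rewrite upper_best_above ?lower_best_above ?ln0 //.
apply: (minimal_cost_best _ _ t1 tot) (mem_tnth n ab); rewrite ?ln0 //.
  by rewrite sumE -upper_best_above -?lower_best_above ?ln0.
exact: attains_inf_minimal_cost (lt_trans ltr01 t1) s0 attains.
Qed.
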